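(* Let $(V,E)$ be an unrooted leafless directed tree and let $\lambda=(\lambda_v)_{v\in V}$ be a weight, i.e. a family of non-zero scalars in $\mathbb{K}$. Let $B_\lambda$ be the associated weighted backward shift. (a) Let $X=\ell^1(V)$, and let $B_\lambda$ be bounded on $X$. Then $B_\lambda$ is chain recurrent if and only if for every $v\in V$, both (i) $\sum_{n=0}^\infty\sup_{u\in\mathrm{Chi}^n(v)}|\lambda(v\to u)|=\infty$, and (ii) $\lim_{n\to \infty} \sum_{j=0}^{n-1} \sup_{u\in \mathrm{Chi}^j(\mathrm{par}^n(v))} \left| \frac{\lambda (\mathrm{par}^n(v)\to u)}{\lambda(\mathrm{par}^n(v)\to v)} \right| = \infty$. (b) Let $X=\ell^p(V)$, $1<p<\infty$, and let $B_\lambda$ be bounded on $X$. Then $B_\lambda$ is chain recurrent if and only if for every $v\in V$, both (i) $\sum_{n=0}^\infty \big(\sum_{u\in \mathrm{Chi}^n(v)} |\lambda(v\to u)|^{p^*}\big)^{1/p^*}=\infty$, and (ii) $\lim_{n\to \infty} \sum_{j=0}^{n-1} \left( \sum_{u\in \mathrm{Chi}^{j} (\mathrm{par}^n(v))} \left| \frac{\lambda (\mathrm{par}^n(v)\to u)}{\lambda(\mathrm{par}^n(v)\to v)} \right|^{p^*} \right)^{1/p^*} = \infty$. (c) Let $X=c_0(V)$, and let $B_\lambda$ be bounded on $X$. Then $B_\lambda$ is chain recurrent if and only if for every $v\in V$, both (i) $\sum_{n=0}^\infty \sum_{u\in \mathrm{Chi}^n(v)} |\lambda(v\to u)|=\infty$,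 and (ii) $\lim_{n\to \infty} \sum_{j=0}^{n-1} \sum_{u\in \mathrm{Chi}^{j} (\mathrm{par}^n(v))} \left| \frac{\lambda (\mathrm{par}^n(v)\to u)}{\lambda(\mathrm{par}^n(v)\to v)} \right|=\infty$.
   Context: Directed trees. A directed tree $(V,E)$ is a connected directed graph with countable vertex set $V$ and edge set $E\subset V\times V\setminus\{(v,v):v\in V\}$ such that: it has no cycles; each vertex $v$ has at most one parent, i.e. a unique vertex $\mathrm{par}(v)$ with $(\mathrm{par}(v),v)\in E$; and there is at most one vertex with no parent, called the root if it exists. The tree is unrooted if it has no root. $\mathrm{par}^n$ is the $n$-fold iterate of $\mathrm{par}$, with $\mathrm{par}^0(v)=v$. A child of $v$ is a vertex whose parent is $v$; $\mathrm{Chi}(v)$ is the set of children of $v$; $\mathrm{Chi}^0(v)=\{v\}$ and, for $n\ge1$, $\mathrm{Chi}^n(v)$ is the union of the sets $\mathrm{Chi}(w)$ over $w\in\mathrm{Chi}^{n-1}(v)$. A leaf is a vertex with no children; the tree is leafless if it has no leaf. Spaces. $\mathbb{K}$ is $\mathbb{R}$ or $\mathbb{C}$. For $1\le p<\infty$, $\ell^p(V)=\{f\in\mathbb{K}^V:\sum_{v\in V}|f(v)|^p<\infty\}$ with norm $\|f\|_p=(\sum_{v}|f(v)|^p)^{1/p}$; $c_0(V)$ is the space of $f\in\mathbb{K}^V$ such that for every $\varepsilon>0$ there is a finite $F\subset V$ with $|f(v)|<\varepsilon$ for all $v\in V\setminus F$, with the supremum norm. For $1<p<\infty$, $p^*$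 is the number with $1/p+1/p^*=1$. Shifts. For a weight $\lambda$, the weighted backward shift is $[B_\lambda(f)](v)=\sum_{u\in\mathrm{Chi}(v)}\lambda_u f(u)$ for $v\in V$. ''$B_\lambda$ is bounded on $X$'' means it is a well-defined continuous linear operator $X\to X$. For $n\ge1$ and $u\in\mathrm{Chi}^n(v)$, $\lambda(v\to u)=\lambda_{\mathrm{par}^{n-1}(u)}\cdots\lambda_{\mathrm{par}(u)}\lambda_u$ (so $\lambda_v$ is not included), and $\lambda(v\to v)=1$. Chain recurrence. For a map $f:X\to X$ on a metric space $(X,d)$ and $\delta>0$, a $\delta$-chain from $x$ to $y$ is a finite sequence $(x_j)_{j=0}^k$, $k\ge1$, with $x_0=x$, $x_k=y$ and $d(f(x_j),x_{j+1})\le\delta$ for $0\le j<k$. The map $f$ is chain recurrent if for every $x\in X$ and every $\delta>0$ there is a $\delta$-chain for $f$ from $x$ to itself. *)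

(* Defs.v *)
From HB Require Import structures.
From mathcomp Require Import all_boot all_order all_algebra finmap.
From mathcomp Require Import all_classical all_reals all_analysis.
From mathcomp Require Import complex.
From mathcomp.analysis Require showcase.summability.

Set Implicit Arguments.
Unset Strict Implicit.
Unset Printing Implicit Defensive.

Import Order.TTheory GRing.Theory Num.Theory numFieldNormedType.Exports.

Local Open Scope classical_set_scope.
Local Open Scope ring_scope.
Local Open Scope complex_scope.

Variant scalar_kind := RealScalars | ComplexScalars.

Definition scalar_field (R : realType) (k : scalar_kind) : numFieldType :=
  match k with
  | RealScalars => R
  | ComplexScalars => R[i]
  end.

(* The norm of the [numFieldType] [scalar_field R k] takes values in that field
   itself; [modulus] is the same quantity as an element of [R]. *)
Definition modulus (R : realType) (k : scalar_kind) : scalar_field R k -> R :=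
  match k return scalar_field R k -> R with
  | RealScalars => fun x : R => `|x|
  | ComplexScalars => fun z : R[i] => complex.Re `|z|
  end.

Section DirectedTree.
Variables (V : countType) (E : rel V).

Definition tree_connected :=
  forall v w : V,
    exists2 s : seq V, path (fun x y => E x y || E y x) v s & last v s = w.

(* Directed cycles, of any length at least 1. *)
Definition tree_acyclic := forall s : seq V, ucycle E s -> s = [::].

Definition has_parent (v : V) := exists u, E u v.

Definition directed_tree :=
  [/\ irreflexive E,
      tree_connected,
      tree_acyclic,
      (forall u u' v, E u v -> E u' v -> u = u') &
      (forall v w, ~ has_parent v -> ~ has_parent w -> v = w)].

Definition unrooted := forall v, has_parent v.

(* The value at a vertex without parent is the junk value [v]. *)
Definition par (v : V) : V := xget v [set u | E u v].

Definition Chi (v : V) : set V := [set u | E v u].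

Definition leafless := forall v, Chi v !=set0.

Fixpoint Chin (n : nat) (v : V) : set V :=
  if n is m.+1 then \bigcup_(w in Chin m v) Chi w else [set v].

End DirectedTree.

Section Shift.
Variables (R : realType) (k : scalar_kind) (V : countType) (E : rel V).
Variable lam : V -> scalar_field R k.

(* [path_weight n u] is lambda(v -> u) for u in Chi^n(v), that is, for
   v = par^n(u). *)
Definition path_weight (n : nat) (u : V) : scalar_field R k :=
  \prod_(i < n) lam (iter i (par E) u).

Definition shift_term (f : V -> scalar_field R k) (v u : V) : scalar_field R k :=
  if u \in Chi E v then lam u * f u else 0.

(* The possibly infinite sum over the children of [v] is unordered: it is the
   limit of the finite partial sums along the directed set of finite sets. *)
Definition shift_sum_cvg (f : V -> scalar_field R k) (v : V) :=
  cvg (summability.partial_sum (shift_term f v) @ summability.totally).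

Definition backward_shift (f : V -> scalar_field R k) (v : V) : scalar_field R k :=
  lim (summability.partial_sum (shift_term f v) @ summability.totally).

End Shift.

Section Spaces.
Variables (R : realType) (k : scalar_kind) (V : countType).

Definition lp_space (p : R) : set (V -> scalar_field R k) :=
  [set f | (\esum_(v in [set: V]) (modulus (f v) `^ p)%:E < +oo)%E].

Definition lp_norm (p : R) (f : V -> scalar_field R k) : R :=
  fine (\esum_(v in [set: V]) (modulus (f v) `^ p)%:E) `^ p^-1.

Definition c0_space : set (V -> scalar_field R k) :=
  [set f | forall e : R, 0 < e ->
    exists2 F : set V, finite_set F & forall v, ~ F v -> modulus (f v) < e].

Definition sup_norm (f : V -> scalar_field R k) : R :=
  sup (range (fun v => modulus (f v))).

Definition norm_dist (N : (V -> scalar_field R k) -> R) (f g : V -> scalar_field R k) : R :=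
  N (fun v => f v - g v).

Definition bounded_shift_on (E : rel V) (lam : V -> scalar_field R k)
    (X : set (V -> scalar_field R k)) (N : (V -> scalar_field R k) -> R) :=
  let B := backward_shift E lam in
  [/\ (forall f, X f -> forall v, shift_sum_cvg E lam f v),
      (forall f, X f -> X (B f)),
      (forall (a : scalar_field R k) f g, X f -> X g ->
         B (fun v => a * f v + g v) = (fun v => a * B f v + B g v)) &
      (forall f, X f -> forall e : R, 0 < e -> exists2 d : R, 0 < d &
         forall g, X g -> norm_dist N f g < d -> norm_dist N (B f) (B g) < e)].

End Spaces.

Section ChainRecurrence.
Variables (R : realType) (T : Type).
Variables (X : set T) (d : T -> T -> R) (f : T -> T).

Definition delta_chain (delta : R) (x y : T) :=
  exists (m : nat) (s : nat -> T),
    [/\ (0 < m)%N,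
        (forall j, (j <= m)%N -> X (s j)),
        s 0%N = x,
        s m = y &
        (forall j, (j < m)%N -> d (f (s j)) (s j.+1) <= delta)].

Definition chain_recurrent_on :=
  forall x, X x -> forall delta : R, 0 < delta -> delta_chain delta x x.

End ChainRecurrence.

(* Main.v *)
From HB Require Import structures.
Require Import Defs.
From mathcomp Require Import all_boot all_order all_algebra finmap.
From mathcomp Require Import all_classical all_reals all_analysis.
From mathcomp Require Import complex ring.
From mathcomp.analysis Require showcase.summability.
Import Order.TTheory GRing.Theory Num.Theory numFieldNormedType.Exports.
Local Open Scope classical_set_scope.
Local Open Scope ring_scope.

Set Implicit Arguments.
Unset Strict Implicit.
Unset Printing Implicit Defensive.

(** Let [D_j(w)] be the norm of the functional [f |-> (B^j f)(w)], that is, the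
dual norm of [u |-> lambda(w -> u)] on [Chi^j(w)].  A [d]-chain of length [n]
from [x] to [y] amounts to [y = B^n x + \sum_(j < n) B^j g_j] with errors
[|g_j| <= d].

Necessity.  Evaluating a chain from [e_v] to itself at [v], where [B^n e_v]
vanishes, gives [1 <= d * \sum_(j < n) D_j(v)], hence (i).  Repeating this chain
with slowly decreasing scalar factors gives a chain from [e_v] to 0, which can
be prolonged by zeros to any length [n >= L]; evaluating it at [w = par^n(v)],
where [B^n e_v] is [lambda(w -> v)], gives
[lambda(w -> v) <= d * \sum_(j < n) D_j(w)] for all [n >= L], hence (ii).

Sufficiency.  If [g] is supported in [Chi^j(w)] then [B^j g] is a multiple of
[e_w], and norming vectors [g_j] for [D_j(w)] make [\sum_(j < n) B^j g_j] any
multiple of [e_w] below [\sum_(j < n) D_j(w)].  So (i) produces chains from 0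
to [e_v], and (ii) produces chains from [e_v] to 0 that cancel
[B^n e_v = lambda(w -> v) e_w].  Adding such chains reaches all finitely
supported vectors, which are dense. *)

(** * The scalar field *)

Section Modulus.
Variables (R : realType) (k : scalar_kind).
Notation K := (scalar_field R k).
Implicit Types x y : K.

(** The norm on [R[i]] is a real number seen in [R[i]]; the complex cases below carry its laws over
    to [R] through the injective embedding of [R]. *)
Lemma complex_normE (z : R[i]) : `|z| = (complex.Re `|z|)%:C%C.
Proof. by case: z. Qed.

Lemma modulus_ge0 x : 0 <= modulus x.
Proof.
case: k x => /= [x|x]; first exact: normr_ge0.
by rewrite -(@lecR R) -complex_normE normr_ge0.
Qed.

Lemma modulusD x y : modulus (x + y) <= modulus x + modulus y.
Proof.
case: k x y => /= x y; first exact: ler_normD.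
by rewrite -(@lecR R) rmorphD/= -!complex_normE ler_normD.
Qed.

Lemma modulusM x y : modulus (x * y) = modulus x * modulus y.
Proof.
case: k x y => /= x y; first exact: normrM.
by apply: (@complexI R); rewrite rmorphM/= -!complex_normE normrM.
Qed.

Lemma modulus0 : modulus (0 : K) = 0.
Proof.
by case: k; [exact: normr0 | exact: (congr1 (@complex.Re R) (normr0 R[i]%C))].
Qed.

Lemma modulus1 : modulus (1 : K) = 1.
Proof.
by case: k; [exact: normr1 | exact: (congr1 (@complex.Re R) (normr1 R[i]%C))].
Qed.

Lemma modulusN x : modulus (- x) = modulus x.
Proof. by case: k x => x; [exact: normrN | exact: (congr1 (@complex.Re R)
  (normrN x))]. Qed.

Lemma modulus_eq0 x : (modulus x == 0) = (x == 0).
Proof.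
case: k x => /= x; first exact: normr_eq0.
by rewrite -(@normr_eq0 _ _ x) [in RHS]complex_normE -(inj_eq (@complexI R))
  rmorph0.
Qed.

Lemma modulus_gt0 x : (0 < modulus x) = (x != 0).
Proof. by rewrite lt_neqAle modulus_ge0 andbT eq_sym modulus_eq0. Qed.

Lemma modulusV x : modulus x^-1 = (modulus x)^-1.
Proof.
case: k x => /= x; first exact: normfV.
by apply: (@complexI R); rewrite fmorphV/= -!complex_normE normfV.
Qed.

Lemma modulus_sum (I : Type) (s : seq I) (F : I -> K) :
  modulus (\sum_(i <- s) F i) <= \sum_(i <- s) modulus (F i).
Proof.
elim: s => [|i s IH]; first by rewrite !big_nil modulus0.
by rewrite !big_cons (le_trans (modulusD _ _))// lerD2l.
Qed.

Definition of_real : R -> K :=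
  match k return R -> scalar_field R k with
  | RealScalars => id
  | ComplexScalars => @real_complex R
  end.

Lemma of_real_is_zmod_morphism : zmod_morphism of_real.
Proof. by rewrite /of_real; case: k => x y //=; rewrite rmorphB. Qed.

Lemma of_real_is_monoid_morphism : monoid_morphism of_real.
Proof. by rewrite /of_real; case: k; split => //= x y; rewrite rmorphM. Qed.

HB.instance Definition _ :=
  GRing.isZmodMorphism.Build R K of_real of_real_is_zmod_morphism.
HB.instance Definition _ :=
  GRing.isMonoidMorphism.Build R K of_real of_real_is_monoid_morphism.

Lemma modulus_of_real (r : R) : modulus (of_real r) = `|r|.
Proof.
rewrite /of_real; case: k => //=.
by rewrite expr0n/= addr0 sqrtr_sqr.
Qed.

End Modulus.

(** * The tree and the shift on basis vectors *)

Section Tree.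
Variables (V : countType) (E : rel V).
Hypotheses (treeE : directed_tree E) (unrootedE : unrooted E).

(** The tree is unrooted, so the default value of [par] never occurs. *)
Lemma par_edge v : E (par E v) v.
Proof. by rewrite /par; case: xgetP => [u _ //|nE];
  have [u /nE] := unrootedE v. Qed.

Lemma edgeE u v : E u v = (u == par E v).
Proof.
have [_ _ _ par_unique _] := treeE.
by apply/idP/eqP => [Euv|->];
  [exact: par_unique Euv (par_edge v)|exact: par_edge].
Qed.

Lemma ChinE n v : Chin E n v = [set u | iter n (par E) u = v].
Proof.
elim: n => [|n IH] /=; first by apply/seteqP; split.
rewrite IH; apply/seteqP; split => [u [w <-]|u <-] /=.
  by rewrite /Chi/= edgeE => /eqP ->; rewrite -iterSr.
by exists (par E u); [rewrite /= -iterSr|rewrite /Chi/= par_edge].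
Qed.

Lemma Chin_nonempty n v : leafless E -> Chin E n v !=set0.
Proof.
move=> leaflessE; elim: n => [|n [w vw]] /=; first by exists v.
by have [u wu] := leaflessE w; exists u, w.
Qed.

(** The vertices met up to the least return time, read from ancestor to descendant, would form a
    simple directed cycle. *)
Lemma iter_par_neq n v : (0 < n)%N -> iter n (par E) v != v.
Proof.
have [_ _ acyclicE _ _] := treeE.
move=> n0; apply/negP => ret.
have exP : exists m, (0 < m)%N && (iter m (par E) v == v) by exists n;
  rewrite n0.
case: (ex_minnP exP) => -[//|m] /= /eqP retm minm.
suff /acyclicE/(congr1 size) : ucycle E (rev (traject (par E) v m.+1)).
  by rewrite size_rev size_traject.
apply/andP; rewrite rev_cycle rev_uniq looping_uniq; split; last first.
  (* A repetition par^m(v) = par^i(v) with i < m would give par^(i+1)(v) = v, against the minimality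
     of [m.+1]. *)
  apply/negP => /trajectP[i im mi].
  by have := minm i.+1; rewrite /= -mi retm eqxx ltnS leqNgt im => /(_ isT).
rewrite /= rcons_path last_traject edgeE retm eqxx andbT.
apply: sub_path (fpath_traject (par E) v m) => x y /eqP <-.
by rewrite edgeE.
Qed.

End Tree.

Section ShiftDelta.
Variables (R : realType) (k : scalar_kind) (V : countType).
Notation K := (scalar_field R k).

Definition delta (v : V) : V -> K := fun w => (w == v)%:R.

Lemma deltaE v w : delta v w = (w == v)%:R. Proof. by []. Qed.

Definition trunc (s : seq V) (f : V -> K) : V -> K :=
  fun v => if v \in s then f v else 0.

Lemma trunc_cons v s f : v \notin s ->
  trunc (v :: s) f = (fun w => f v * delta v w + trunc s f w).
Proof.
move=> vs; apply/funext => w; rewrite /trunc /delta inE.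
by have [->|_] := eqVneq w v; rewrite ?(negPf vs) ?mulr1 ?addr0 ?mulr0 ?add0r.
Qed.

Lemma sub_truncE s f v : (f - trunc s f) v = if v \in s then 0 else f v.
Proof.
by change (f v - trunc s f v = if v \in s then 0 else f v); rewrite /trunc;
  case: ifP; rewrite ?subrr ?subr0.
Qed.

(** Every finite set containing [u] gives the partial sum [x u], so the partial sums are eventually
    constant. *)
Lemma lim_partial_sum1 (x : V -> K) (u : V) : (forall w, w != u -> x w = 0) ->
  lim (summability.partial_sum x @ summability.totally) = x u.
Proof.
move=> x0.
have totP := @summability.totally_filter V.
apply: (@lim_near_cst K^o (@norm_hausdorff K K^o) _ summability.totally).
exists [fset u]%fset => // A /= uA; rewrite /summability.partial_sum.
have uinA : u \in A by apply: (fsubsetP uA); rewrite inE.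
rewrite (bigD1 [` uinA]%fset)//= big1 ?addr0// => i iu.
by apply: x0; apply: contra iu => /eqP iu; apply/eqP/val_inj.
Qed.

Variables (E : rel V) (lam : V -> K).
Hypotheses (treeE : directed_tree E) (unrootedE : unrooted E).

Lemma backward_shift_delta u : backward_shift E lam (delta u) =
  (fun v => lam u * delta (par E u) v).
Proof.
apply/funext => v; rewrite /backward_shift (@lim_partial_sum1 _ u); last first.
  by move=> w wu; rewrite /shift_term /delta (negPf wu) mulr0 if_same.
rewrite /shift_term /delta eqxx mulr1.
have -> : (u \in Chi E v) = (v == par E u).
  by rewrite -(edgeE treeE unrootedE); apply/idP/idP => [/set_mem|/mem_set].
by case: ifP; rewrite ?mulr1 ?mulr0.
Qed.

End ShiftDelta.

(** * Chains of a linear operator on a sequence space *)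

Section LinearDynamics.
Variables (R : realType) (k : scalar_kind) (V : countType).
Notation K := (scalar_field R k).
Notation delta := (@delta R k V).
Implicit Types (f g x y z : V -> K) (d e : R).

(** The properties shared by l^p and c_0 on which the dynamical argument rests, so that the three
    cases are treated at once. *)
Record sequence_space (X : set (V -> K)) (N : (V -> K) -> R) : Prop :=
  SequenceSpace {
  space0 : X 0;
  space_delta : forall v, X (delta v);
  space_lin : forall a f g, X f -> X g -> X (a \*o f + g);
  norm_space_ge0 : forall f, X f -> 0 <= N f;
  norm_scale : forall a f, X f -> N (a \*o f) <= modulus a * N f;
  norm_add : forall f g, X f -> X g -> N (f + g) <= N f + N g;
  norm_eval : forall f v, X f -> modulus (f v) <= N f;
  norm_delta : forall v, N (delta v) <= 1;
  trunc_dense : forall f e, X f -> 0 < e ->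
    exists2 s, uniq s & N (f - trunc s f) < e
}.

(* [D S a] is the norm of the functional [f |-> \sum_(u in S) a u * f u]. *)
Record dual_norm (X : set (V -> K)) (N : (V -> K) -> R)
    (D : set V -> (V -> K) -> \bar R) : Prop := DualNorm {
  dual_ge0 : forall S a, S !=set0 -> (0 <= D S a)%E;
  dual_le : forall (S : set V) a f s (r : R), X f -> uniq s ->
    (forall u, u \in s -> S u) -> 0 <= r -> (D S a <= r%:E)%E ->
    modulus (\sum_(u <- s) a u * f u) <= r * N f;
  dual_attained : forall (S : set V) a (t : R), 0 <= t -> (t%:E < D S a)%E ->
    exists s f, [/\ uniq s, (forall u, u \in s -> S u), N (trunc s f) <= 1 &
                    \sum_(u <- s) a u * f u = of_real k t]
}.

Variables (X : set (V -> K)) (N : (V -> K) -> R).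
Hypothesis XN : sequence_space X N.

Lemma spaceZ a f : X f -> X (a \*o f).
Proof.
move=> Xf; have -> : a \*o f = (a - 1) \*o f + f.
  by apply/funext => v; rewrite fctE /=; ring.
exact: (space_lin XN).
Qed.

Lemma spaceD f g : X f -> X g -> X (f + g).
Proof.
move=> Xf Xg; have -> : f + g = 1 \*o f + g.
  by apply/funext => v; rewrite !fctE /= mul1r.
exact: (space_lin XN).
Qed.

Lemma spaceN f : X f -> X (- f).
Proof.
move=> /(spaceZ (-1)); congr X.
by apply/funext => v; rewrite !fctE /= mulN1r.
Qed.

Lemma spaceB f g : X f -> X g -> X (f - g).
Proof. by move=> Xf /spaceN; exact: spaceD. Qed.

Lemma normN f : X f -> N (- f) <= N f.
Proof.
move=> /(norm_scale XN (-1)); rewrite modulusN modulus1 mul1r.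
by congr (N _ <= _); apply/funext => v; rewrite !fctE /= mulN1r.
Qed.

Let X0 : X 0 := space0 XN.

Lemma norm0 : N 0 = 0.
Proof.
apply/le_anti; rewrite (norm_space_ge0 XN)// andbT.
have := norm_scale XN 0 X0; rewrite modulus0 mul0r; congr (N _ <= _).
by apply/funext => v; exact: mul0r.
Qed.

Lemma space_sum (I : Type) (s : seq I) (F : I -> V -> K) :
  (forall i, X (F i)) -> X (\sum_(i <- s) F i).
Proof.
move=> XF; elim: s => [|i s IH]; first by rewrite big_nil.
by rewrite big_cons; exact: spaceD.
Qed.

Lemma trunc_sum s f : uniq s -> trunc s f = \sum_(u <- s) (f u \*o delta u).
Proof.
elim: s => [_|u s IH /= /andP[us us']]; first by rewrite big_nil; apply/funext.
by rewrite trunc_cons// big_cons -IH.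
Qed.

Lemma space_trunc s f : uniq s -> X (trunc s f).
Proof.
move=> us; rewrite trunc_sum//; apply: space_sum => u.
by apply: spaceZ; exact: (space_delta XN).
Qed.

Variable B : (V -> K) -> V -> K.
Hypotheses (BX : forall f, X f -> X (B f))
  (Blin : forall a f g, X f -> X g -> B (a \*o f + g) = a \*o B f + B g).

Lemma mul1o f : 1 \*o f = f.
Proof. by apply/funext => v /=; rewrite mul1r. Qed.

Lemma operatorD f g : X f -> X g -> B (f + g) = B f + B g.
Proof. by move=> Xf Xg; have := Blin 1 Xf Xg; rewrite !mul1o. Qed.

Lemma operator0 : B 0 = 0.
Proof. by apply: (@addrI _ (B 0)); rewrite -operatorD// !addr0. Qed.

Lemma operatorZ a f : X f -> B (a \*o f) = a \*o B f.
Proof. by move=> Xf; have := Blin a Xf X0; rewrite operator0 !addr0. Qed.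

Lemma iter_space n f : X f -> X (iter n B f).
Proof. by move=> Xf; elim: n => //= n; exact: BX. Qed.

Lemma iterD_op n f g : X f -> X g -> iter n B (f + g) = iter n B f + iter n B g.
Proof.
by move=> Xf Xg; elim: n => //= n ->; rewrite operatorD//; exact: iter_space.
Qed.

Lemma iterZ_op n a f : X f -> iter n B (a \*o f) = a \*o iter n B f.
Proof.
by move=> Xf; elim: n => //= n ->; rewrite operatorZ//; exact: iter_space.
Qed.

Lemma iter0_op n : iter n B 0 = 0.
Proof. by elim: n => //= n ->; exact: operator0. Qed.

Lemma iterN_op n f : X f -> iter n B (- f) = - iter n B f.
Proof.
move=> Xf; apply/eqP; rewrite -addr_eq0 -iterD_op ?addNr ?iter0_op//.
exact: spaceN.
Qed.

Lemma iter_sum_op n (I : Type) (s : seq I) (F : I -> V -> K) :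
  (forall i, X (F i)) ->
  iter n B (\sum_(i <- s) F i) = \sum_(i <- s) iter n B (F i).
Proof.
move=> XF; elim: s => [|i s IH]; first by rewrite !big_nil iter0_op.
by rewrite !big_cons iterD_op ?IH//; exact: space_sum.
Qed.

(* A [d]-chain [x = x_0, ..., x_n = y], recorded through its errors
   [g j = x_(n-j) - B x_(n-j-1)]. *)
Definition reach n d x y := exists g : nat -> V -> K,
  (forall j, X (g j) /\ N (g j) <= d) /\
  y = iter n B x + \sum_(j < n) iter j B (g j).

Lemma reach_orbit n d x : 0 <= d -> reach n d x (iter n B x).
Proof.
move=> d0; exists (fun=> 0); split=> [_|]; first by rewrite norm0.
by rewrite big1 ?addr0// => j _; exact: iter0_op.
Qed.

Lemma reach00 n d : 0 <= d -> reach n d 0 0.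
Proof. by move=> d0; have := reach_orbit n 0 d0; rewrite iter0_op. Qed.

Lemma reach_space n d x y : X x -> reach n d x y -> X y.
Proof.
move=> Xx [g [gX ->]]; apply: spaceD; first exact: iter_space.
by apply: space_sum => j; apply: iter_space; apply: (gX _).1.
Qed.

Lemma reach_le n d e x y : d <= e -> reach n d x y -> reach n e x y.
Proof.
move=> de [g [gX ->]]; exists g; split => // j.
by have [? ?] := gX j; split => //; exact: le_trans de.
Qed.

Lemma reach_add n d e x y x' y' : X x -> X x' ->
  reach n d x y -> reach n e x' y' -> reach n (d + e) (x + x') (y + y').
Proof.
move=> Xx Xx' [g [gX ->]] [h [hX ->]]; exists (fun j => g j + h j); split.
  move=> j; have [[Xg Ng] [Xh Nh]] := (gX j, hX j); split; first exact: spaceD.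
  by rewrite (le_trans (norm_add XN Xg Xh))// lerD.
rewrite iterD_op// addrACA -big_split/=; congr (_ + _).
by apply: eq_bigr => j _; rewrite iterD_op;
  [| apply: (gX _).1 | apply: (hX _).1].
Qed.

Lemma reach_scale n a d x y : X x -> reach n d x y ->
  reach n (modulus a * d) (a \*o x) (a \*o y).
Proof.
move=> Xx [g [gX ->]]; exists (fun j => a \*o g j); split.
  move=> j; have [Xg Ng] := gX j; split; first exact: spaceZ.
  by rewrite (le_trans (norm_scale XN a Xg))// ler_wpM2l// modulus_ge0.
have -> : \sum_(j < n) iter j B (a \*o g j) = a \*o \sum_(j < n) iter j B (g j).
  rewrite (eq_bigr (fun j : 'I_n => a \*o iter j B (g j))); last first.
    by move=> j _; rewrite iterZ_op//; apply: (gX _).1.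
  by apply/funext => v /=; rewrite !fct_sumE mulr_sumr.
by rewrite iterZ_op//; apply/funext => v; rewrite !fctE /= mulrDr.
Qed.

Lemma reach_trans n m d x y z : X x ->
  reach n d x y -> reach m d y z -> reach (m + n) d x z.
Proof.
move=> Xx [g [gX ->]] [h [hX ->]].
(* Errors are counted from the end of the chain, so those of the second chain come first and those
   of the first are shifted by [m]. *)
exists (fun j => if (j < m)%N then h j else g (j - m)%N); split.
  by move=> j; case: ifP => _; [exact: hX|exact: gX].
have Xs : X (\sum_(j < n) iter j B (g j)).
  by apply: space_sum => j; apply: iter_space; apply: (gX _).1.
rewrite iterD_op//; last exact: iter_space.
rewrite iter_sum_op; last by move=> j; apply: iter_space; apply: (gX _).1.
rewrite iterD -addrA; congr (_ + _).
rewrite big_split_ord/= addrC; congr (_ + _); apply: eq_bigr => j _.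
  by rewrite ltn_ord.
by rewrite ltnNge leq_addr/= addKn iterD.
Qed.

(** The endpoint is moved by changing the last error, which has index 0; a length of the form [n.+1]
    ensures that there is one. *)
Lemma reach_end n d e x y z : X z -> X x -> reach n.+1 d x y ->
  N (z - y) <= e ->
  reach n.+1 (d + e) x z.
Proof.
move=> Xz Xx Rxy Nzy; have Xy := reach_space Xx Rxy.
have [g [gX yE]] := Rxy; have Xzy := spaceB Xz Xy.
exists (fun j => if j is j'.+1 then g j else g 0%N + (z - y)); split.
  have e0 := le_trans (norm_space_ge0 XN Xzy) Nzy.
  case=> [|j]; [have [Xg Ng] := gX 0%N|have [Xg Ng] := gX j.+1]; split.
  - exact: spaceD.
  - by rewrite (le_trans (norm_add XN Xg Xzy))// lerD.
  - exact: Xg.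
  - by rewrite (le_trans Ng)// lerDl.
move: yE; rewrite !big_ord_recl/= => yE.
by rewrite -(subrK y z) {2}yE; ring.
Qed.

(** A chain depends on its initial point only through the image under [B], so moving this point
    changes the first error, of index [n], by [B x - B z]. *)
Lemma reach_start n d e x y z : X x -> X z -> reach n.+1 d x y ->
  N (B x - B z) <= e -> reach n.+1 (d + e) z y.
Proof.
move=> Xx Xz [g [gX ->]] Nxz; have Xxz := spaceB (BX Xx) (BX Xz).
have e0 := le_trans (norm_space_ge0 XN Xxz) Nxz.
exists (fun j => if j == n then g n + (B x - B z) else g j); split.
  move=> j; have [Xg Ng] := gX j; case: eqP => [<-|_]; split => //.
  - exact: spaceD.
  - by rewrite (le_trans (norm_add XN Xg Xxz))// lerD.
  - by rewrite (le_trans Ng)// lerDl.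
rewrite !big_ord_recr/= eqxx iterD_op//; last exact: (gX _).1.
rewrite (iterD_op _ (BX Xx)); last exact: spaceN (BX Xz).
rewrite iterN_op; last exact: BX.
have -> : \sum_(j < n) iter j B (if j == n :> nat then g n + (B x - B z) else
  g j) =
    \sum_(j < n) iter j B (g j).
  by apply: eq_bigr => j _; rewrite ltn_eqF.
by rewrite -!iterSr !iterS; ring.
Qed.

Lemma reach_chain n d x y : (0 < n)%N -> X x -> reach n d x y ->
  delta_chain X (norm_dist N) B d x y.
Proof.
move=> n0 Xx [g [gX ->]].
(* The point at time [i] contains the errors made so far, whose indices run from [n - i] to
   [n - 1]. *)
exists n, (fun i => iter i B x + \sum_(j < i) iter j B (g (n - i + j)%N)).
have Xsum i : X (\sum_(j < i) iter j B (g (n - i + j)%N)).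
  by apply: space_sum => j; apply: iter_space; exact: (gX _).1.
split => //.
- by move=> i _; apply: spaceD => //; exact: iter_space.
- by rewrite big_ord0 addr0.
- by rewrite subnn.
move=> i im; rewrite /norm_dist.
rewrite (_ : (fun v => _) = - g (n - i.+1)%N).
  by rewrite (le_trans (normN (gX _).1))// (gX _).2.
change (B (iter i B x + \sum_(j < i) iter j B (g (n - i + j)%N)) -
  (iter i.+1 B x + \sum_(j < i.+1) iter j B (g (n - i.+1 + j)%N)) = - g (n -
    i.+1)%N).
rewrite operatorD//; last exact: iter_space.
have := iter_sum_op 1 (index_enum 'I_i) (fun j : 'I_i =>
  iter_space j (gX (n - i + j)%N).1).
move=> /= ->; rewrite big_ord_recl/= addn0.
have -> : \sum_(j < i) B (iter (0 + j) B (g (n - i.+1 + bump 0 j)%N)) =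
    \sum_(j < i) B (iter j B (g (n - i + j)%N)).
  by apply: eq_bigr => j _; rewrite /bump/= add1n addnS -addSn subnSK.
by ring.
Qed.

Lemma chain_reach d x y : X x -> delta_chain X (norm_dist N) B d x y ->
  exists2 n, (0 < n)%N & reach n d x y.
Proof.
move=> Xx [m [s [m0 Xs s0 sm ch]]]; exists m => //; rewrite -sm.
suff Hi i : (i <= m)%N -> reach i d x (s i) by exact: Hi.
elim: i => [_|i IH im].
  (* [reach] bounds every [g j], even at length 0; the sign of [d] comes from the first step of the
     chain, which exists because [0 < m]. *)
  have d0 : 0 <= d.
    apply: le_trans (ch 0%N m0); apply: (norm_space_ge0 XN).
    by apply: spaceB; [apply: BX|]; apply: Xs.
  by rewrite s0; exact: (reach_orbit 0).
have [g [gX siE]] := IH (ltnW im).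
(* The new error is the latest one, so it takes index 0 and the earlier ones move up. *)
exists (fun j => if j is j'.+1 then g j' else s i.+1 - B (s i)).
have Xsi : X (B (s i)) by apply: BX; apply: Xs; exact: ltnW.
split=> [[|j]|]; last 2 first.
- exact: gX.
- rewrite big_ord_recl/= addrCA.
  have -> : B (s i) = iter i.+1 B x + \sum_(j < i) iter j.+1 B (g j).
    rewrite siE operatorD; [|exact: iter_space|]; last first.
      by apply: space_sum => j; apply: iter_space; exact: (gX _).1.
    congr (_ + _).
    exact: (iter_sum_op 1 (index_enum 'I_i) (fun j : 'I_i =>
      iter_space j (gX j).1)).
  by rewrite /= subrK.
split; first by apply: spaceB => //; exact: Xs.
rewrite -opprB (le_trans (normN _))//; first by apply: spaceB => //; exact: Xs.
exact: ch.
Qed.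

End LinearDynamics.

(** * Chain recurrence of the shift in terms of dual norms *)

(** Finite [s] and [t] share [A] in proportion, with ratio [A / (s + t) < 1]; an infinite summand
    takes all of [A]. The alternatives [a = 0] and [b = 0] cover a summand that vanishes or receives
    nothing. *)
Lemma split_lte_add (R : realType) (A : R) (S D : \bar R) :
  0 <= A -> (0 <= S)%E -> (0 <= D)%E -> (A%:E < S + D)%E ->
  exists a b, [/\ 0 <= a, 0 <= b, A = a + b,
    a = 0 \/ (a%:E < S)%E & b = 0 \/ (b%:E < D)%E].
Proof.
move=> A0; case: S => [s| |] //; case: D => [t| |] //; rewrite ?lee_fin.
- move=> s0 t0; rewrite -EFinD lte_fin => ltA.
  have st0 : 0 < s + t by exact: le_lt_trans ltA.
  have q0 : 0 <= A / (s + t) by rewrite divr_ge0// ltW.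
  have q1 : A / (s + t) < 1 by rewrite ltr_pdivrMr// mul1r.
  have lt_part (r : R) : 0 <= r ->
    A / (s + t) * r = 0 \/ ((A / (s + t) * r)%:E < r%:E)%E.
    rewrite le_eqVlt => /predU1P[<-|r0]; first by left; rewrite mulr0.
    by right; rewrite lte_fin gtr_pMl.
  exists (A / (s + t) * s), (A / (s + t) * t); split; try exact: lt_part.
  - exact: mulr_ge0.
  - exact: mulr_ge0.
  - by rewrite -mulrDr divfK// gt_eqF.
- by move=> *; exists 0, A; rewrite add0r lexx ltry; split=> //; [left|right].
- by move=> *; exists A, 0; rewrite addr0 lexx ltry; split=> //; [right|left].
- by move=> *; exists A, 0; rewrite addr0 lexx ltry; split=> //; [right|left].
Qed.

Section ShiftDynamics.
Variables (R : realType) (k : scalar_kind) (V : countType) (E : rel V).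
Notation K := (scalar_field R k).
Notation delta := (@delta R k V).
Variable lam : V -> K.
Hypotheses (treeE : directed_tree E) (unrootedE : unrooted E)
  (leaflessE : leafless E) (lam_neq0 : forall v, lam v != 0).
Variables (X : set (V -> K)) (N : (V -> K) -> R) (D : set V -> (V -> K) ->
  \bar R).
Hypotheses (XN : sequence_space X N) (dualD : dual_norm X N D)
  (bndB : bounded_shift_on E lam X N).

Local Notation B := (backward_shift E lam).
Local Notation pw := (path_weight E lam).
Local Notation par := (par E).
Local Notation reach := (reach X N B).
Implicit Types (f g x y z : V -> K) (c : K) (d e : R).

Let BX f : X f -> X (B f). Proof. by case: bndB => _ + _ _; apply. Qed.
Let Blin a f g : X f -> X g -> B (a \*o f + g) = a \*o B f + B g.
Proof. by case: bndB => _ _ + _; apply. Qed.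
Let Xdelta v : X (delta v) := space_delta XN v.

Lemma path_weight_neq0 n u : pw n u != 0.
Proof. by apply/prodf_neq0 => i _. Qed.

Lemma iter_shift_delta n u : iter n B (delta u) = pw n u \*o delta (iter n
  par u).
Proof.
elim: n => [|n IH]; first by rewrite /path_weight big_ord0 mul1o.
rewrite /= IH (operatorZ XN Blin)// backward_shift_delta// /path_weight
  big_ord_recr.
by apply/funext => v /=; rewrite mulrA.
Qed.

Lemma iter_shift_trunc n s f : uniq s ->
  iter n B (trunc s f) = \sum_(u <- s) ((pw n u * f u) \*o delta (iter n par
    u)).
Proof.
move=> us; rewrite trunc_sum// (iter_sum_op XN BX Blin); last first.
  by move=> u; apply: (spaceZ XN).
apply: eq_bigr => u _; rewrite (iterZ_op XN BX Blin)// iter_shift_delta.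
by apply/funext => v /=; rewrite mulrA (mulrC (f u)).
Qed.

Lemma iter_shift_continuous n f e : X f -> 0 < e -> exists2 d, 0 < d &
  forall g, X g -> N (f - g) < d -> N (iter n B f - iter n B g) < e.
Proof.
move=> Xf; elim: n e => [|n IH] e e0; first by exists e.
have [_ _ _ cont] := bndB.
have [d d0 dP] := cont _ (iter_space BX n Xf) e e0.
have [d' d'0 d'P] := IH d d0; exists d' => // g Xg /(d'P _ Xg).
by apply: dP; exact: iter_space.
Qed.

(** The norm of [f |-> (B^j f)(w) / c]. Condition (i) uses [c = 1], condition (ii) uses c = lambda(w
    -> v) with w = par^n(v). *)
Definition level_norm c w j : \bar R := D (Chin E j w) (fun u => pw j u / c).

(** Levels of a leafless tree are nonempty; this matters for l^1, where the supremum over an empty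
    level would be [-oo]. *)
Lemma level_norm_ge0 c w j : (0 <= level_norm c w j)%E.
Proof. by apply: (dual_ge0 dualD); apply: Chin_nonempty. Qed.

(** For finitely supported vectors this is the dual norm inequality. The general case follows by
    truncating [g]: evaluation at [w] and [B^j] are continuous, so the remainder costs an
    arbitrarily small [e]. *)
Lemma iter_shift_le c w j g d : X g -> c != 0 -> 0 < d -> N g <= d ->
  ((modulus (iter j B g w / c))%:E <= d%:E * level_norm c w j)%E.
Proof.
move=> Xg c0 d0 Ngd.
have := level_norm_ge0 c w j; case De : (level_norm c w j) => [r| |]// r0;
  last first.
  by rewrite gt0_muley ?lte_fin// leey.
rewrite -EFinM lee_fin; rewrite lee_fin in r0.
apply/ler_addgt0Pr => e e0.
have mc0 : 0 < modulus c by rewrite modulus_gt0.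
have [h h0 hP] := iter_shift_continuous j Xg (mulr_gt0 e0 mc0).
have [s us sP] := trunc_dense XN Xg h0.
have Xt := space_trunc XN g us.
have XBt : X (iter j B g - iter j B (trunc s g)).
  by apply: (spaceB XN); exact: iter_space.
have -> : iter j B g w / c =
    iter j B (trunc s g) w / c + (iter j B g - iter j B (trunc s g)) w / c.
  by rewrite -mulrDl; congr (_ / c); exact: (esym (subrKC _ _)).
rewrite (le_trans (modulusD _ _))// lerD//; last first.
  rewrite modulusM modulusV ler_pdivrMr// (le_trans (norm_eval XN _ XBt))//.
  by apply: ltW; exact: hP.
(* Only the vertices of [s] in Chi^j(w) contribute to the value at [w]. *)
pose s' := [seq u <- s | iter j par u == w].
have -> : iter j B (trunc s g) w / c = \sum_(u <- s') pw j u / c * g u.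
  rewrite iter_shift_trunc// fct_sumE big_filter mulr_suml [RHS]big_mkcond/=.
  apply: eq_bigr => u _; rewrite deltaE eq_sym.
  by case: eqP => _; rewrite ?mulr1 ?mulr0 ?mul0r// mulrAC.
have us' : uniq s' by exact: filter_uniq.
apply: (@le_trans _ _ (r * N g)); last by rewrite mulrC ler_wpM2r.
apply: (dual_le dualD (S := Chin E j w)) => //.
- by move=> u; rewrite mem_filter => /andP[/eqP uw _]; rewrite ChinE.
- by rewrite -/(level_norm c w j) De.
Qed.

Lemma reach_le_level c w n d x y : X x -> c != 0 -> 0 < d -> reach n d x y ->
  ((modulus ((y w - iter n B x w) / c))%:E <=
   d%:E * \sum_(0 <= j < n) level_norm c w j)%E.
Proof.
move=> Xx c0 d0 [g [gX ->]].
have -> : (iter n B x + \sum_(j < n) iter j B (g j)) w - iter n B x w =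
    \sum_(j < n) iter j B (g j) w.
  by rewrite !fctE addrC addrA addNr add0r fct_sumE.
rewrite mulr_suml big_mkord ge0_sume_distrr; last first.
  by move=> j _; exact: level_norm_ge0.
rewrite (le_trans (_ : _ <= \sum_(j < n) (modulus (iter j B (g j) w /
  c))%:E)%E)//.
  by rewrite sumEFin lee_fin modulus_sum.
by apply: lee_sum => j _; have [? ?] := gX j; exact: iter_shift_le.
Qed.

(** A vector norming the level is supported in Chi^j(w), where [B^j] sends every basis vector to a
    multiple of [delta w]; the factor [c] undoes the division in [level_norm]. The case [t = 0] is
    the one left open by [split_lte_add]. *)
Lemma level_attained c w j (t : R) : c != 0 -> 0 <= t ->
  t = 0 \/ (t%:E < level_norm c w j)%E ->
  exists g, [/\ X g, N g <= 1 & iter j B g = (c * of_real k t) \*o delta w].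
Proof.
move=> c0 t0 [->|]; last move=> /(dual_attained dualD t0)[s [f [us sS Nf
  sumE]]].
  exists 0; rewrite (norm0 XN) ler01; split => //; first exact: (space0 XN).
  rewrite (iter0_op XN Blin) rmorph0 mulr0; apply/funext => v; exact/esym/mul0r.
exists (trunc s f); split => //; first exact: (space_trunc XN).
rewrite iter_shift_trunc// -sumE.
transitivity (\sum_(u <- s) ((pw j u * f u) \*o delta w)).
  apply: eq_big_seq => u /sS; rewrite ChinE//= => -> //.
apply/funext => v; rewrite fct_sumE/= -!mulr_suml mulr_sumr; congr (_ * _).
apply: eq_bigr => u _; by rewrite mulrA (mulrCA c) mulfV// mulr1.
Qed.

Lemma sum_level_attained c w n (A : R) : c != 0 -> 0 <= A ->
  (A%:E < \sum_(0 <= j < n) level_norm c w j)%E ->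
  exists g : nat -> V -> K, (forall j, X (g j) /\ N (g j) <= 1) /\
    \sum_(j < n) iter j B (g j) = (c * of_real k A) \*o delta w.
Proof.
move=> c0; elim: n A => [|n IH] A A0.
  by rewrite big_geq// lte_fin ltNge A0.
rewrite big_nat_recr//= => /split_lte_add[]//.
- by apply: sume_ge0 => j _; exact: level_norm_ge0.
- exact: level_norm_ge0.
move=> a [b [a0 b0 -> aP bP]].
have [h [Xh Nh hE]] := level_attained c0 b0 bP.
have [g [gX gE]] : exists g : nat -> V ->
  K, (forall j, X (g j) /\ N (g j) <= 1) /\
    \sum_(j < n) iter j B (g j) = (c * of_real k a) \*o delta w.
  case: aP => [->|/IH]; last exact.
  exists (fun=> 0); split.
    by rewrite (norm0 XN) ler01; split => //; exact: (space0 XN).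
  rewrite big1 => [|j _]; last by rewrite (iter0_op XN Blin).
  by rewrite rmorph0 mulr0; apply/funext => v; exact/esym/mul0r.
exists (fun j => if j == n then h else g j); split.
  by move=> j; case: eqP.
rewrite big_ord_recr/= eqxx hE.
have -> : \sum_(j < n) iter j B (if j == n :> nat then h else g j) =
    \sum_(j < n) iter j B (g j).
  by apply: eq_bigr => j _; rewrite ltn_eqF.
by rewrite gE rmorphD mulrDr; apply/funext => v; rewrite !fctE /= mulrDl.
Qed.

End ShiftDynamics.

(** * Chains between 0 and basis vectors, and the criterion in terms of dual norms *)

Section ChainRecurrentShift.
Variables (R : realType) (k : scalar_kind) (V : countType) (E : rel V).
Notation K := (scalar_field R k).
Notation delta := (@delta R k V).
Variable lam : V -> K.
Hypotheses (treeE : directed_tree E) (unrootedE : unrooted E)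
  (leaflessE : leafless E) (lam_neq0 : forall v, lam v != 0).
Variables (X : set (V -> K)) (N : (V -> K) -> R) (D : set V -> (V -> K) ->
  \bar R).
Hypotheses (XN : sequence_space X N) (dualD : dual_norm X N D)
  (bndB : bounded_shift_on E lam X N).

Local Notation B := (backward_shift E lam).
Local Notation pw := (path_weight E lam).
Local Notation par := (par E).
Local Notation reach := (reach X N B).
Local Notation level_norm := (level_norm E lam D).
Implicit Types (f g x y z : V -> K) (c : K) (d e : R).

Let BX f : X f -> X (B f). Proof. by case: bndB => _ + _ _; apply. Qed.
Let Blin a f g : X f -> X g -> B (a \*o f + g) = a \*o B f + B g.
Proof. by case: bndB => _ _ + _; apply. Qed.
Let X0 : X 0 := space0 XN.
Let Xdelta v : X (delta v) := space_delta XN v.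

Lemma mulo0 c : c \*o (0 : V -> K) = 0.
Proof. by apply/funext => v; exact: mulr0. Qed.

(* Running the chain once multiplies [delta v] by a slightly smaller scalar. *)
Lemma reach_delta0 m d v : (0 < m)%N -> 0 < d ->
  reach m d (delta v) (delta v) ->
  exists n, reach n (d + d) (delta v) 0.
Proof.
case: m => // m _ d0 loop.
(* [M0.+1] loops lower the scalar from 1 to 0 in steps of size at most [d]; each decrement is
   absorbed by the last error of its loop. *)
have [M0 M] : exists M : nat, M.+1%:R^-1 <= d.
  exists (Num.trunc d^-1); rewrite -[leRHS]invrK lef_pV2 ?posrE ?invr_gt0//.
  by apply/ltW/truncnS_gt.
pose c i : R := 1 - i%:R / M0.+1%:R.
suff step i : (i <= M0.+1)%N ->
  reach (i * m.+1) (d + d) (delta v) (of_real k (c i) \*o delta v).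
  exists (M0.+1 * m.+1)%N; have := step M0.+1 (leqnn _).
  rewrite /c divff ?pnatr_eq0// subrr rmorph0.
  by congr (reach _ _ _); apply/funext => w; exact: mul0r.
elim: i => [_|i IH iM].
  rewrite /c mul0r subr0 rmorph1 mul1o.
  by apply: (reach_orbit XN Blin 0); rewrite addr_ge0// ltW.
rewrite mulSn; apply: (reach_trans XN BX Blin) (IH (ltnW iM)) _ => //.
(* The loop scaled by [c i] keeps errors at most [d]; the decrement accounts for the other [d]. *)
have ci : modulus (of_real k (c i)) <= 1.
  rewrite modulus_of_real /c ger0_norm.
    by rewrite gerBl divr_ge0.
  by rewrite subr_ge0 ler_pdivrMr// mul1r ler_nat ltnW.
have XZ a u : X (a \*o delta u) by exact: (spaceZ XN).
apply: (reach_end XN BX) => //.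
  apply: (reach_le _ (reach_scale XN BX Blin (of_real k (c i)) (Xdelta v)
    loop)).
  by rewrite ger_pMl.
have -> : of_real k (c i.+1) \*o delta v - of_real k (c i) \*o delta v =
    of_real k (- M0.+1%:R^-1) \*o delta v.
  apply/funext => w; rewrite !fctE/= -mulrBl -rmorphB; congr (of_real k _ * _).
  by rewrite /c -natr1 mulrDl mul1r; ring.
apply: le_trans M; rewrite (le_trans (norm_scale XN _ (Xdelta v)))//.
by rewrite modulus_of_real normrN ger0_norm// ler_piMr// (norm_delta XN).
Qed.

(** Since par^m(v) differs from [v], the orbit of [delta v] contributes nothing at [v], and the
    value 1 there comes from the errors alone. *)
Lemma loop_level_sum m d v : (0 < m)%N -> 0 < d ->
  reach m d (delta v) (delta v) ->
  ((d^-1)%:E <= \sum_(0 <= j < m) level_norm 1 v j)%E.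
Proof.
move=> m0 d0 /(reach_le_level treeE unrootedE leaflessE XN dualD bndB v
  (Xdelta v) (oner_neq0 _) d0).
rewrite (iter_shift_delta treeE unrootedE XN bndB) /= !deltaE eqxx eq_sym.
rewrite (negPf (iter_par_neq treeE unrootedE v m0)) mulr0 subr0 divr1 modulus1.
by rewrite -lee_pdivrMl// mule1.
Qed.

(** The errors must cancel [B^n (delta v)] at par^n(v); dividing by its value there normalises the
    amount to cancel to modulus 1. *)
Lemma reach0_level_sum n d v : 0 < d -> reach n d (delta v) 0 ->
  ((d^-1)%:E <= \sum_(0 <= j < n) level_norm (pw n v) (iter n par v) j)%E.
Proof.
move=> d0.
move=> /(reach_le_level treeE unrootedE leaflessE XN dualD bndB (iter n par v)
  (Xdelta v) (path_weight_neq0 E lam_neq0 n v) d0).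
rewrite (iter_shift_delta treeE unrootedE XN bndB) /= deltaE eqxx mulr1 sub0r.
rewrite mulNr divff ?(path_weight_neq0 E)// modulusN modulus1.
by rewrite -lee_pdivrMl// mule1.
Qed.

Lemma reach_from0_delta v d : 0 < d ->
  (\sum_(0 <= n <oo) level_norm 1 v n = +oo)%E ->
  exists n, reach n d 0 (delta v).
Proof.
move=> d0 sumoo.
have [n nP] : exists n, ((d^-1)%:E < \sum_(0 <= j < n) level_norm 1 v j)%E.
  apply: contrapT => /forallNP small.
  suff : (\sum_(0 <= n <oo) level_norm 1 v n <= (d^-1)%:E)%E by rewrite sumoo.
  apply: lime_le.
    by apply: is_cvg_nneseries => j _ _;
      exact: (level_norm_ge0 _ leaflessE dualD).
  by apply: nearW => n; rewrite leNgt; apply/negP; exact: small.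
have [|g [gX gE]] := sum_level_attained treeE unrootedE leaflessE XN dualD
  bndB (oner_neq0 _) _ nP.
  by rewrite invr_ge0 ltW.
(* Errors of norm at most 1 reach [delta v] divided by [d]; rescaling by [d] gives the required
   chain. *)
exists n; have R1 : reach n 1 0 (of_real k d^-1 \*o delta v).
  by exists g; split => //; rewrite gE (iter0_op XN Blin) add0r mul1r.
have := reach_scale XN BX Blin (of_real k d) X0 R1.
rewrite modulus_of_real gtr0_norm// mulr1 mulo0.
congr (reach _ _ _); apply/funext => w /=.
by rewrite mulrA -rmorphM/= divff ?gt_eqF// rmorph1 mul1r.
Qed.

Lemma reach_delta_to0 v d n : 0 < d ->
  ((d^-1)%:E < \sum_(0 <= j < n) level_norm (pw n v) (iter n par v) j)%E ->
  reach n d (delta v) 0.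
Proof.
move=> d0 nP; have c0 := path_weight_neq0 E lam_neq0 n v.
have [|g [gX gE]] := sum_level_attained treeE unrootedE leaflessE XN dualD
  bndB c0 _ nP.
  by rewrite invr_ge0 ltW.
have R1 : reach n 1 0 ((pw n v * of_real k d^-1) \*o delta (iter n par v)).
  by exists g; split => //; rewrite gE (iter0_op XN Blin) add0r.
(* The factor [- d] turns the endpoint into the opposite of [B^n (delta v)], and adding the
   error-free orbit of [delta v] then gives 0. *)
have := reach_scale XN BX Blin (of_real k (- d)) X0 R1.
rewrite modulus_of_real normrN gtr0_norm// mulr1 mulo0.
have := reach_orbit XN Blin n (delta v) (lexx 0).
move=> /(reach_add XN BX Blin (Xdelta v) X0) /[apply].
rewrite add0r addr0 (iter_shift_delta treeE unrootedE XN bndB).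
congr (reach _ _ _); apply/funext => w.
transitivity (pw n v * delta (iter n par v) w * (1 + of_real k (- d) *
  of_real k d^-1)).
  by rewrite !fctE/=; ring.
by rewrite -rmorphM/= mulNr divff ?gt_eqF// rmorphN1 subrr mulr0.
Qed.

(** Chains from 0 can wait at 0 before starting, so those for single vertices are brought to a
    common length and added. Hence all large lengths occur. *)
Lemma reach_from0_trunc s f d : 0 < d -> uniq s ->
  (forall v e, 0 < e -> exists n, reach n e 0 (delta v)) ->
  exists n0, forall n, (n0 <= n)%N -> reach n d 0 (trunc s f).
Proof.
move=> d0 us from0.
have from0Z v c e : 0 < e -> exists n0, forall n, (n0 <= n)%N ->
  reach n e 0 (c \*o delta v).
  (* Adding 1 keeps the divisor positive when [c] vanishes. *)
  move=> e0; have mc0 : 0 < modulus c + 1 by rewrite ltr_wpDl// modulus_ge0.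
  have [n nP] := from0 v (e / (modulus c + 1)) (divr_gt0 e0 mc0).
  exists n => n' nn'.
  have := reach_scale XN BX Blin c X0 nP; rewrite mulo0 => nP'.
  rewrite -(subnKC nn').
  apply: (reach_trans XN BX Blin) => //;
    first exact: (reach00 XN Blin _ (ltW e0)).
  apply: reach_le nP'; rewrite mulrA ler_pdivrMr// mulrC ler_wpM2l ?ltW//.
  by rewrite ltrDl.
elim: s d d0 us => [|v s IH] d d0.
  exists 0%N => n _; have -> : trunc [::] f = 0 by apply/funext.
  exact: (reach00 XN Blin _ (ltW d0)).
move=> /= /andP[vs us]; have d20 : 0 < d / 2 by rewrite divr_gt0.
have [n1 n1P] := IH _ d20 us.
have [n2 n2P] := from0Z v (f v) _ d20.
exists (maxn n1 n2) => n; rewrite geq_max => /andP[le1 le2].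
rewrite [d]splitr trunc_cons// -(addr0 (0 : V -> K)).
by apply: (reach_add XN BX Blin) => //; [exact: n2P|exact: n1P].
Qed.

(** Here the chains wait at 0 after arriving, which again allows a common length. *)
Lemma reach_trunc_to0 s f d : 0 < d -> uniq s ->
  (forall v e, 0 < e -> exists n, reach n e (delta v) 0) ->
  exists n0, forall n, (n0 <= n)%N -> reach n d (trunc s f) 0.
Proof.
move=> d0 us to0.
have to0Z v c e : 0 < e -> exists n0, forall n, (n0 <= n)%N ->
  reach n e (c \*o delta v) 0.
  move=> e0; have mc0 : 0 < modulus c + 1 by rewrite ltr_wpDl// modulus_ge0.
  have [n nP] := to0 v (e / (modulus c + 1)) (divr_gt0 e0 mc0).
  exists n => n' nn'.
  have := reach_scale XN BX Blin c (Xdelta v) nP; rewrite mulo0 => nP'.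
  rewrite -(subnK nn').
  have nP'' : reach n e (c \*o delta v) 0.
    apply: reach_le nP'; rewrite mulrA ler_pdivrMr// mulrC ler_wpM2l ?ltW//.
    by rewrite ltrDl.
  apply: (reach_trans XN BX Blin _ nP''); first exact: (spaceZ XN).
  exact: (reach00 XN Blin _ (ltW e0)).
elim: s d d0 us => [|v s IH] d d0.
  exists 0%N => n _; have -> : trunc [::] f = 0 by apply/funext.
  exact: (reach00 XN Blin _ (ltW d0)).
move=> /= /andP[vs us]; have d20 : 0 < d / 2 by rewrite divr_gt0.
have [n1 n1P] := IH _ d20 us.
have [n2 n2P] := to0Z v (f v) _ d20.
exists (maxn n1 n2) => n; rewrite geq_max => /andP[le1 le2].
rewrite [d]splitr trunc_cons// -[X in reach _ _ _ X](addr0 (0 : V -> K)).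
apply: (reach_add XN BX Blin).
- exact: (spaceZ XN).
- exact: (space_trunc XN).
- exact: n2P.
- exact: n1P.
Qed.

Theorem chain_recurrent_shiftP : chain_recurrent_on X (norm_dist N) B <->
  forall v,
    (\sum_(0 <= n <oo) level_norm 1 v n = +oo)%E /\
    (fun n => \sum_(0 <= j < n) level_norm (pw n v) (iter n par v) j)%E @ \oo
      --> +oo%E.
Proof.
have ge0 := level_norm_ge0 lam leaflessE dualD.
split=> [cr v|levels x Xx d d0].
  have loop d : 0 < d -> exists2 m, (0 < m)%N & reach m d (delta v) (delta v).
    by move=> d0; apply: (chain_reach XN BX Blin) => //; exact: cr.
  split.
    apply: eq_infty => A; have A0 : 0 < (`|A| + 1)^-1
      by rewrite invr_gt0 ltr_wpDl.
    have [m m0 /(loop_level_sum m0 A0)] := loop _ A0.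
    rewrite invrK => Am; apply: (@le_trans _ _ (`|A| + 1)%:E).
      by rewrite lee_fin (le_trans (ler_norm A))// lerDl.
    by apply: (le_trans Am); apply: nneseries_lim_ge => j _ _; exact: ge0.
  apply/cvgeyPge => A.
  (* Halved because [reach_delta0] doubles the error. *)
  have A0 : 0 < (`|A| + 1)^-1 / 2 by rewrite divr_gt0// invr_gt0 ltr_wpDl.
  have [m m0 /(reach_delta0 m0 A0)[L LP]] := loop _ A0.
  near=> n.
  have Ln : (L <= n)%N by near: n; exact: nbhs_infty_ge.
  have : reach n (`|A| + 1)^-1 (delta v) 0.
    rewrite [X in reach _ X]splitr -(subnK Ln).
    apply: (reach_trans XN BX Blin _ LP) => //.
    by apply: (reach00 XN Blin); rewrite addr_ge0// ltW.
  move=> /reach0_level_sum; rewrite invr_gt0 ltr_wpDl// => /(_ isT).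
  rewrite invrK; apply: le_trans.
  by rewrite lee_fin (le_trans (ler_norm A))// lerDl.
have from0 v e : 0 < e -> exists n, reach n e 0 (delta v).
  by move=> e0; apply: reach_from0_delta => //; exact: (levels v).1.
have to0 v e : 0 < e -> exists n, reach n e (delta v) 0.
  (* The added 1 yields the strict inequality with [e^-1] that [reach_delta_to0] asks for. *)
  move=> e0; have /cvgeyPge/(_ (e^-1 + 1))[n _ /(_ n (leqnn n)) nP] :=
    (levels v).2.
  exists n; apply: reach_delta_to0 => //; apply: lt_le_trans nP.
  by rewrite lte_fin ltrDl.
have d20 : 0 < d / 2 by rewrite divr_gt0.
have [_ _ _ /(_ x Xx (d / 2) d20)[e e0 eP]] := bndB.
(* The bound [d / 2] allows [x] to replace [trunc s x] as an endpoint, the bound [e] as an initial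
   point. *)
have [s us sP] : exists2 s, uniq s & N (x - trunc s x) < Num.min (d / 2) e.
  by apply: (trunc_dense XN) => //; rewrite lt_min d20.
move: sP; rewrite lt_min => /andP[sd se].
have Xs := space_trunc XN x us.
have [n1 n1P] := reach_from0_trunc x d20 us from0.
have [n2 n2P] := reach_trunc_to0 x d20 us to0.
(* Passing to a successor length provides the step whose error absorbs the correction. *)
have toX : reach n1.+1 d 0 x.
  by rewrite [d]splitr; apply: (reach_end XN BX) (n1P _ (leqnSn _)) (ltW sd).
have fromX : reach n2.+1 d x 0.
  rewrite [d]splitr; apply: (reach_start XN BX Blin _ _ (n2P _ (leqnSn _)))
    => //.
  rewrite -opprB (le_trans (normN XN _))//; first by apply: (spaceB XN);
    exact: BX.
  exact/ltW/eP.
apply: (reach_chain XN BX Blin) (reach_trans XN BX Blin Xx fromX toX) => //.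
Unshelve. all: by end_near. Qed.

End ChainRecurrentShift.

(** * The spaces [lp] and [c0] and their dual norms *)

Section UnorderedSums.
Variables (R : realType) (T : choiceType).
Implicit Types (S : set T) (a : T -> R) (s : seq T).

Lemma sum_le_esum S a s : uniq s -> (forall u, u \in s -> S u) ->
  ((\sum_(u <- s) a u)%:E <= \esum_(u in S) (a u)%:E)%E.
Proof.
move=> us sS; apply: esum_ge; exists [set` s]; first by split.
by rewrite -sumEFin fsbig_seq.
Qed.

Lemma lt_esum S a (t : R) : (t%:E < \esum_(u in S) (a u)%:E)%E ->
  exists s, [/\ uniq s, (forall u, u \in s -> S u) & t < \sum_(u <- s) a u].
Proof.
move=> /ereal_sup_gt[_ [F [finF FS] <-]].
rewrite fsbig_finite// sumEFin lte_fin => tF.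
exists (fset_set F); split => //.
by move=> u; rewrite in_fset_set// => /set_mem/FS.
Qed.

Lemma esum_leP S a (r : R) :
  (forall s, uniq s -> (forall u, u \in s -> S u) -> \sum_(u <- s) a u <= r) ->
  (\esum_(u in S) (a u)%:E <= r%:E)%E.
Proof.
move=> sr; rewrite leNgt; apply/negP => /lt_esum[s [us sS]].
by rewrite ltNge sr.
Qed.

End UnorderedSums.

Lemma powR_invr (R : realType) (x r : R) : 0 < x -> x^-1 `^ r = (x `^ r)^-1.
Proof. by move=> x0; rewrite -powR_inv1 ?ltW// -powRrM mulN1r powRN. Qed.

(** * The spaces l^p and Minkowski's inequality *)

Section LpSpace.
Variables (R : realType) (k : scalar_kind) (V : countType) (p : R).
Hypothesis p1 : 1 <= p.
Notation K := (scalar_field R k).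
Notation delta := (@delta R k V).
Local Notation lp_sum f := (\esum_(v in [set: V]) (modulus (f v) `^ p)%:E)%E.
Local Notation lp := (@lp_space R k V p).
Local Notation N := (@lp_norm R k V p).
Implicit Types (f g : V -> K) (s : seq V) (M : R).

Let p0 : 0 < p. Proof. exact: lt_le_trans p1. Qed.

Lemma ge0_powR_le (x y : R) : 0 <= x -> 0 <= y -> x `^ p <= y `^ p -> x <= y.
Proof.
move=> x0 y0; rewrite !leNgt; apply: contra => yx.
by apply: gt0_ltr_powR.
Qed.

Lemma lp_norm_ge0 f : 0 <= N f.
Proof. exact: powR_ge0. Qed.

Lemma lp_sumE f : lp f -> lp_sum f = (N f `^ p)%:E.
Proof.
move=> Xf; rewrite /lp_norm -powRrM mulVf ?gt_eqF// powRr1.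
  by rewrite fineK// ge0_fin_numE// esum_ge0// => v _; rewrite lee_fin powR_ge0.
by rewrite fine_ge0// esum_ge0// => v _; rewrite lee_fin powR_ge0.
Qed.

(** Reduces membership and norm bounds to finite sums, where the estimates below are made. *)
Lemma lp_normP f M : 0 <= M ->
  (forall s, uniq s -> \sum_(v <- s) modulus (f v) `^ p <= M `^ p) <->
  lp f /\ N f <= M.
Proof.
move=> M0; split=> [sM|[Xf NM] s us].
  have le_sum : (lp_sum f <= (M `^ p)%:E)%E by apply: esum_leP => s us _;
    exact: sM.
  have Xf : lp f by exact: le_lt_trans le_sum (ltry _).
  split=> //; move: le_sum; rewrite lp_sumE// lee_fin.
  by apply: ge0_powR_le => //; exact: lp_norm_ge0.
apply: (@le_trans _ _ (N f `^ p));
  last by apply: ge0_ler_powR (ltW p0) _ _ _ _ NM => //; exact: lp_norm_ge0.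
by rewrite -lee_fin -lp_sumE// sum_le_esum.
Qed.

Lemma lp_sum_le f s : lp f -> uniq s ->
  \sum_(v <- s) modulus (f v) `^ p <= N f `^ p.
Proof. by move=> Xf; apply: (lp_normP f (lp_norm_ge0 f)).2. Qed.

(** Convexity of the power [p], since (x + y) / (c + d) is the mean of x / c and y / d with weights
    c / (c + d) and d / (c + d). *)
Lemma powR_add_le (x y c d : R) : 0 <= x -> 0 <= y -> 0 < c -> 0 < d ->
  (x + y) `^ p <= (c + d) `^ p * (c / (c + d) * (x `^ p / c `^ p) + d / (c +
    d) * (y `^ p / d `^ p)).
Proof.
move=> x0 y0 c0 d0; have cd0 : 0 < c + d by exact: addr_gt0.
have t0 : 0 <= c / (c + d) by rewrite divr_ge0// ltW.
have t1 : c / (c + d) <= 1 by rewrite ler_pdivrMr// mul1r lerDl ltW.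
have xc0 : 0 <= x / c by rewrite divr_ge0// ltW.
have yd0 : 0 <= y / d by rewrite divr_ge0// ltW.
have := @convex_powR R p p1 (Itv01 t0 t1) (x / c) (y / d).
rewrite !inE/= !in_itv/= !andbT => /(_ xc0 yd0).
move=> cvx; rewrite convRE [X in X `^ _ <= _]convRE/= /unstable.onem in cvx.
move: cvx; have -> : 1 - c / (c + d) = d / (c + d) by field; rewrite gt_eqF.
have -> : c / (c + d) * (x / c) + d / (c + d) * (y / d) = (x + y) / (c + d).
  by field; rewrite !gt_eqF.
have [cV dV cdV] : [/\ 0 <= c^-1, 0 <= d^-1 & 0 <= (c + d)^-1].
  by rewrite !invr_ge0; split; exact: ltW.
rewrite (powRM _ x0 cV) (powRM _ y0 dV) (powRM _ (addr_ge0 x0 y0) cdV).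
by rewrite !powR_invr// ler_pdivrMr ?powR_gt0// mulrC.
Qed.

(** Summing [powR_add_le] over the coordinates leaves the two weights, whose total is 1. Positive
    bounds [c] and [d] replace the norms, which may be 0. *)
Lemma lp_add_le f g (c d : R) : lp f -> lp g -> 0 < c -> 0 < d ->
  N f <= c -> N g <= d -> lp (f + g) /\ N (f + g) <= c + d.
Proof.
move=> Xf Xg c0 d0 Nfc Ngd; have cd0 : 0 < c + d by exact: addr_gt0.
apply/lp_normP; first exact: ltW.
move=> s us.
have fc : \sum_(v <- s) modulus (f v) `^ p <= c `^ p.
  exact: (lp_normP f (ltW c0)).2.
have gd : \sum_(v <- s) modulus (g v) `^ p <= d `^ p.
  exact: (lp_normP g (ltW d0)).2.
apply: (@le_trans _ _ (\sum_(v <- s) (c + d) `^ p *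
  (c / (c + d) * (modulus (f v) `^ p / c `^ p) +
   d / (c + d) * (modulus (g v) `^ p / d `^ p)))).
  apply: ler_sum => v _.
  rewrite (le_trans _ (powR_add_le (modulus_ge0 _) (modulus_ge0 _) c0 d0))//.
  apply: ge0_ler_powR; rewrite ?nnegrE ?modulus_ge0 ?(ltW p0)//.
    by rewrite addr_ge0// modulus_ge0.
  exact: modulusD.
rewrite -mulr_sumr big_split/= -!mulr_sumr -!mulr_suml.
rewrite ger_pMr ?powR_gt0//.
have -> : 1 = c / (c + d) + d / (c + d) by field; rewrite gt_eqF.
apply: lerD; (rewrite ger_pMr ?divr_gt0// ler_pdivrMr ?powR_gt0// mul1r//).
Qed.

Lemma lp_add f g : lp f -> lp g -> lp (f + g) /\ N (f + g) <= N f + N g.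
Proof.
move=> Xf Xg.
have addle e : 0 < e -> lp (f + g) /\ N (f + g) <= N f + N g + e.
  move=> e0; have e20 : 0 < e / 2 by rewrite divr_gt0.
  rewrite {1}[e]splitr addrACA.
  apply: lp_add_le Xf Xg (ltr_wpDl (lp_norm_ge0 f) e20) (ltr_wpDl
    (lp_norm_ge0 g) e20) _ _;
    by rewrite lerDl ltW.
split; first by have [] := addle _ ltr01.
by apply/ler_addgt0Pr => e e0; have [] := addle _ e0.
Qed.

Lemma lp_scale (a : K) f : lp f ->
  lp (a \*o f) /\ N (a \*o f) <= modulus a * N f.
Proof.
move=> Xf; apply/lp_normP => [|s us].
  by rewrite mulr_ge0 ?modulus_ge0 ?lp_norm_ge0.
rewrite powRM ?modulus_ge0 ?lp_norm_ge0//.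
under eq_bigr do rewrite /= modulusM powRM ?modulus_ge0//.
by rewrite -mulr_sumr ler_wpM2l ?powR_ge0// lp_sum_le.
Qed.

Lemma lp_delta v : lp (delta v) /\ N (delta v) <= 1.
Proof.
apply/lp_normP => // s us; rewrite powR1.
have delta_powR w : modulus (delta v w) `^ p = (w == v)%:R.
  rewrite deltaE; case: eqP => _; rewrite ?modulus1 ?powR1//.
  by rewrite modulus0 powR0// gt_eqF.
under eq_bigr do rewrite delta_powR.
have [vs|vs] := boolP (v \in s).
  by rewrite (bigD1_seq v)//= eqxx big1 ?addr0// => w /negPf ->.
by rewrite big1_seq// => w /= ws; case: eqP => // wv; rewrite -wv ws in vs.
Qed.

Lemma lp_trunc_dense f (e : R) : lp f -> 0 < e ->
  exists2 s, uniq s & N (f - trunc s f) < e.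
Proof.
move=> Xf e0; have h0 : 0 < e / 2 by rewrite divr_gt0.
have : ((N f `^ p - (e / 2) `^ p)%:E < lp_sum f)%E.
  by rewrite lp_sumE// lte_fin ltrBlDr ltrDl powR_gt0.
move=> /lt_esum[s [us _]]; rewrite ltrBlDr => ltN.
exists s => //; apply: (@le_lt_trans _ _ (e / 2));
  last by rewrite ltr_pdivrMr// ltr_pMr// ltr1n.
apply: (proj2 (proj1 (lp_normP _ (ltW h0)) _)) => s' us';
  pose s1 := [seq v <- s' | v \notin s].
have -> : \sum_(v <- s') modulus ((f - trunc s f) v) `^ p =
    \sum_(v <- s1) modulus (f v) `^ p.
  rewrite big_filter [RHS]big_mkcond; apply: eq_bigr => v _.
  rewrite sub_truncE; case: ifP => //= _.
  by rewrite modulus0 powR0// gt_eqF.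
have /(lp_sum_le Xf) : uniq (s ++ s1).
  rewrite cat_uniq us filter_uniq// andbT; apply/hasPn => v.
  by rewrite mem_filter => /andP[].
rewrite big_cat/= => le1; rewrite -(lerD2l (\sum_(v <- s) modulus (f v) `^ p)).
exact: le_trans le1 (ltW ltN).
Qed.

Lemma lp_sequence_space : sequence_space lp N.
Proof.
split.
- apply: (proj1 (proj1 (lp_normP 0 (lexx 0)) _)) => s us.
  by rewrite big1 ?powR_ge0// => v _; rewrite modulus0 powR0// gt_eqF.
- by move=> v; exact: (lp_delta v).1.
- by move=> a f g Xf Xg; apply: (lp_add _ Xg).1; exact: (lp_scale a Xf).1.
- by move=> f _; exact: lp_norm_ge0.
- by move=> a f /(lp_scale a)[].
- by move=> f g Xf Xg; exact: (lp_add Xf Xg).2.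
- move=> f v Xf; have := lp_sum_le (s := [:: v]) Xf isT.
  by rewrite big_seq1; apply: ge0_powR_le; rewrite ?modulus_ge0 ?lp_norm_ge0.
- by move=> v; exact: (lp_delta v).2.
- exact: lp_trunc_dense.
Qed.

End LpSpace.

(** * The space c_0 and its dual norm *)

Section C0Space.
Variables (R : realType) (k : scalar_kind) (V : countType).
Notation K := (scalar_field R k).
Notation delta := (@delta R k V).
Local Notation c0 := (@c0_space R k V).
Local Notation N := (@sup_norm R k V).
Implicit Types (f g : V -> K) (s : seq V) (M : R).

Lemma sup_norm_le f M : 0 <= M -> (forall v, modulus (f v) <= M) -> N f <= M.
Proof.
move=> M0 fM; rewrite /sup_norm;
  (* If [V] is empty, so is the range, and its [sup] is 0. *)
  have [->|/set0P ne] := eqVneq (range (fun v => modulus (f v))) set0.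
  by rewrite sup0.
by apply: ge_sup => // _ [v _ <-].
Qed.

Lemma c0_bounded f : c0 f -> exists M, forall v, modulus (f v) <= M.
Proof.
move=> /(_ 1 ltr01)[F finF Fle].
exists (1 + \sum_(v <- fset_set F) modulus (f v)) => v.
have sum0 (P : pred V) : 0 <= \sum_(u <- fset_set F | P u) modulus (f u).
  by apply: sumr_ge0 => u _; exact: modulus_ge0.
have [Fv|/Fle/ltW fv] := pselect (F v); last by rewrite (le_trans fv)// lerDl.
have vF : v \in fset_set F by rewrite in_fset_set// mem_set.
by rewrite (big_rem v)//= addrCA lerDl addr_ge0// sumr_ge0// => u _;
  exact: modulus_ge0.
Qed.

Lemma modulus_le_sup f v : c0 f -> modulus (f v) <= N f.
Proof.
move=> /c0_bounded[M fM]; apply: ub_le_sup; last by exists v.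
by exists M => _ [u _ <-].
Qed.

Lemma sup_norm_ge0 f : c0 f -> 0 <= N f.
Proof.
move=> Xf; have [[v]|noV] := pselect (inhabited V).
  exact: le_trans (modulus_ge0 (f v)) (modulus_le_sup v Xf).
rewrite /sup_norm; suff -> : range (fun v => modulus (f v)) = set0
  by rewrite sup0.
by rewrite -subset0 => x [v _ _]; apply: noV.
Qed.

Lemma c0_sequence_space : sequence_space c0 N.
Proof.
split.
- by move=> e e0; exists set0 => // v _; rewrite modulus0.
- move=> v e e0; exists [set v] => // w /= wv.
  by rewrite deltaE; case: eqP => // _; rewrite modulus0.
- move=> a f g Xf Xg e e0;
  have ma0 : 0 < modulus a + 1 by rewrite ltr_wpDl// modulus_ge0.
  have e20 : 0 < e / 2 by rewrite divr_gt0.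
  have [F finF FP] := Xf _ (divr_gt0 e20 ma0).
  have [G finG GP] := Xg _ e20.
  exists (F `|` G); first by rewrite finite_setU.
  move=> v /not_orP[/FP fv /GP gv].
  change (modulus (a * f v + g v) < e).
  rewrite (le_lt_trans (modulusD _ _))// [e]splitr ler_ltD// modulusM.
  move: fv; rewrite ltr_pdivlMr// => /ltW; apply: le_trans.
  by rewrite mulrDr mulr1 mulrC lerDl modulus_ge0.
- exact: sup_norm_ge0.
- move=> a f Xf; apply: sup_norm_le => [|v].
    by rewrite mulr_ge0 ?modulus_ge0 ?sup_norm_ge0.
  by rewrite /= modulusM ler_wpM2l ?modulus_ge0// modulus_le_sup.
- move=> f g Xf Xg; apply: sup_norm_le => [|v].
    by rewrite addr_ge0 ?sup_norm_ge0.
  by apply: le_trans (modulusD _ _) _; rewrite lerD// modulus_le_sup.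
- by move=> f v /modulus_le_sup.
- move=> v; apply: sup_norm_le => // w.
  by rewrite deltaE; case: eqP; rewrite ?modulus1 ?modulus0.
- move=> f e Xf e0; have e20 : 0 < e / 2 by rewrite divr_gt0.
  have [F finF FP] := Xf _ e20; exists (fset_set F); first exact: fset_uniq.
  apply: (@le_lt_trans _ _ (e / 2)); last first.
    by rewrite ltr_pdivrMr// ltr_pMr// ltr1n.
  apply: sup_norm_le => [|v]; first exact: ltW.
  rewrite sub_truncE; case: ifPn => [_|]; first by rewrite modulus0 ltW.
  by rewrite in_fset_set// => /negP vF; apply/ltW/FP => Fv; apply: vF;
    exact: mem_set.
Qed.

(** Norming vectors are written with a division by [a]; this form also covers the coordinates where
    [a] vanishes. *)
Lemma of_real_div_modulus (a : K) (r : R) : a * (of_real k (r * modulus a) /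
  a) = of_real k (r * modulus a).
Proof.
have [->|a0] := eqVneq a 0; first by rewrite modulus0 mulr0 rmorph0 !mul0r.
by rewrite mulrC divfK.
Qed.

(** The dual of c_0 is l^1: on a finite set, a multiple of the conjugate phase of [a] norms the
    functional. *)
Lemma c0_dual_norm :
  dual_norm c0 N (fun S a => \esum_(u in S) (modulus (a u))%:E)%E.
Proof.
split=> [S a _|S a f s r Xf us sS r0 Sr|S a t t0 /lt_esum[s [us sS ts]]].
- by apply: esum_ge0 => u _; rewrite lee_fin modulus_ge0.
- apply: (@le_trans _ _ (\sum_(u <- s) modulus (a u) * N f)).
    apply: le_trans (modulus_sum _ _) _; apply: ler_sum => u _.
    by rewrite modulusM ler_wpM2l ?modulus_ge0// modulus_le_sup.
  rewrite -mulr_suml ler_wpM2r ?sup_norm_ge0// -lee_fin.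
  exact: le_trans (sum_le_esum _ us sS) Sr.
pose A := \sum_(u <- s) modulus (a u).
have A0 : 0 < A by exact: le_lt_trans ts.
(* The factor [t / A] is less than 1, which bounds the supremum norm, and makes the pairing with [a]
   equal to [t]. *)
exists s, (fun u => of_real k (t / A * modulus (a u)) / a u); split=> //.
  apply: sup_norm_le => // v; rewrite /trunc; case: ifP; rewrite ?modulus0//.
  move=> _; rewrite modulusM modulusV modulus_of_real.
  have tA : 0 <= t / A by exact: divr_ge0 t0 (ltW A0).
  rewrite ger0_norm; last by rewrite mulr_ge0// modulus_ge0.
  have [->|av] := eqVneq (a v) 0; first by rewrite modulus0 invr0 mulr0.
  by rewrite mulfK ?modulus_eq0// ler_pdivrMr// mul1r ltW.
under eq_bigr do rewrite of_real_div_modulus.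
by rewrite -rmorph_sum/= -mulr_sumr divfK// gt_eqF.
Qed.

End C0Space.

(** * The dual norms of l^1 and of l^p for 1 < p *)

Section LpDual.
Variables (R : realType) (k : scalar_kind) (V : countType).
Notation K := (scalar_field R k).

(** The dual of l^1 is l^infinity: a single coordinate where the modulus of [a] exceeds [t] is
    enough to attain [t]. *)
Lemma l1_dual_norm : dual_norm (@lp_space R k V 1) (@lp_norm R k V 1)
  (fun S a => ereal_sup [set (modulus (a u))%:E | u in S]).
Proof.
have l1 := @lp_sequence_space R k V 1 (lexx 1).
split=> [S a [u Su]|S a f s r Xf us sS r0 Sr|S a t t0 /ereal_sup_gt[_ [u Su
  <-]]].
- apply: le_trans (_ : (modulus (a u))%:E <= _)%E;
  first by rewrite lee_fin modulus_ge0.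
  by apply: ereal_sup_ubound; exists u.
- have := lp_sum_le (lexx 1) Xf us; rewrite powRr1 ?lp_norm_ge0// => sN.
  apply: le_trans (modulus_sum _ _) (le_trans _ (ler_wpM2l r0 sN)).
  rewrite mulr_sumr big_seq [leRHS]big_seq; apply: ler_sum => u us'.
  rewrite modulusM powRr1 ?modulus_ge0// ler_wpM2r ?modulus_ge0//.
  by rewrite -lee_fin (le_trans _ Sr)//; apply: ereal_sup_ubound;
    exists u => //; exact: sS.
rewrite lte_fin => tu; have au0 : a u != 0.
  by rewrite -modulus_gt0; exact: le_lt_trans tu.
exists [:: u], (fun=> of_real k t / a u); split => //.
- by move=> v; rewrite inE => /eqP ->.
- rewrite trunc_sum// big_seq1 (le_trans (norm_scale l1 _ (space_delta l1
  u)))//.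
  apply: le_trans (ler_piMr (modulus_ge0 _) (norm_delta l1 u)) _.
  by rewrite modulusM modulusV modulus_of_real ger0_norm// ler_pdivrMr
    ?modulus_gt0// mul1r ltW.
- by rewrite big_seq1 mulrC divfK.
Qed.

Section Conjugate.
Variables p q : R.
Hypotheses (p1 : 1 < p) (pq : p^-1 + q^-1 = 1).

Let p0 : 0 < p. Proof. exact: lt_trans p1. Qed.

Let q0 : 0 < q.
Proof.
rewrite -invr_gt0; have -> : q^-1 = 1 - p^-1 by rewrite -pq addrAC subrr add0r.
by rewrite subr_gt0 invf_lt1.
Qed.

Lemma conjugate_exponentE : p + q = p * q.
Proof.
have : (p^-1 + q^-1) * (p * q) = p * q by rewrite pq mul1r.
by move=> <-; field; rewrite !gt_eqF.
Qed.

(** Young's inequality applied to [f / F] and [a / A] and summed; a zero bound forces all terms to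
    vanish and is treated first. *)
Lemma sum_hoelder (s : seq V) (a f : V -> K) (A F : R) : 0 <= A -> 0 <= F ->
  \sum_(u <- s) modulus (a u) `^ q <= A `^ q ->
  \sum_(u <- s) modulus (f u) `^ p <= F `^ p ->
  \sum_(u <- s) modulus (a u) * modulus (f u) <= A * F.
Proof.
move=> A0 F0 aA fF.
have sum_eq0 (g : V -> K) (r : R) : 0 < r ->
  \sum_(u <- s) modulus (g u) `^ r <= 0 `^ r ->
    forall u, u \in s -> modulus (g u) = 0.
  move=> r0; rewrite powR0 ?gt_eqF// => sum0 u us.
  apply: (@powR_eq0_eq0 _ _ r); apply/le_anti; rewrite powR_ge0 andbT.
  apply: le_trans sum0; rewrite (big_rem u)//= lerDl.
  by apply: sumr_ge0 => v _; exact: powR_ge0.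
move: A0; rewrite le_eqVlt => /predU1P[A0|A0].
  rewrite -A0 mul0r big1_seq// => u /= us.
  by rewrite -A0 in aA; rewrite (sum_eq0 a q)// mul0r.
move: F0; rewrite le_eqVlt => /predU1P[F0|F0].
  rewrite -F0 mulr0 big1_seq// => u /= us.
  by rewrite -F0 in fF; rewrite (sum_eq0 f p)// mulr0.
rewrite -[leRHS]mulr1 -ler_pdivrMl ?mulr_gt0// mulr_sumr.
apply: (@le_trans _ _ (\sum_(u <- s) (modulus (f u) `^ p / F `^ p / p +
                                      modulus (a u) `^ q / A `^ q / q))).
  apply: ler_sum => u _.
  have fF0 : 0 <= modulus (f u) / F by rewrite divr_ge0 ?modulus_ge0 ?ltW.
  have aA0 : 0 <= modulus (a u) / A by rewrite divr_ge0 ?modulus_ge0 ?ltW.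
  have := conjugate_powR fF0 aA0 p0 q0 pq.
  have [FV AV] : 0 <= F^-1 /\ 0 <= A^-1 by rewrite !invr_ge0 !ltW.
  rewrite (powRM _ (modulus_ge0 _) FV) (powRM _ (modulus_ge0 _) AV)
    !powR_invr//.
  by apply: le_trans; rewrite invfM le_eqVlt; apply/orP; left; apply/eqP; ring.
rewrite big_split/= -!mulr_suml -pq; apply: lerD.
  rewrite -[leRHS]mul1r ler_wpM2r ?invr_ge0 ?(ltW p0)// ler_pdivrMr ?powR_gt0//.
  by rewrite mul1r.
rewrite -[leRHS]mul1r ler_wpM2r ?invr_ge0 ?(ltW q0)// ler_pdivrMr ?powR_gt0//.
by rewrite mul1r.
Qed.

(** The dual of l^p is l^q: the bound is Hölder's inequality, and the norming vector is proportional
    to |a|^q / a on a finite set. *)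
Lemma lp_dual_norm : dual_norm (@lp_space R k V p) (@lp_norm R k V p)
  (fun S a => ((\esum_(u in S) (modulus (a u) `^ q)%:E) `^ q^-1)%E).
Proof.
have esumq0 S (a : V -> K) : (0 <= \esum_(u in S) (modulus (a u) `^ q)%:E)%E.
  by apply: esum_ge0 => u _; rewrite lee_fin powR_ge0.
split=> [S a _|S a f s r Xf us sS r0 Sr|S a t t0 tS].
- exact: poweR_ge0.
- apply: le_trans (modulus_sum _ _) _.
  under eq_bigr do rewrite modulusM.
  apply: sum_hoelder => //; first exact: lp_norm_ge0.
    rewrite -lee_fin (le_trans (sum_le_esum _ us sS))//.
    move: Sr (esumq0 S a); case: (\esum_(_ in S) _)%E => [x| |]//.
      rewrite poweR_EFin !lee_fin => xr x0.
      rewrite -[x]powRr1// -(@mulVf _ q) ?gt_eqF// powRrM.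
      by apply: ge0_ler_powR => //; rewrite ?nnegrE ?powR_ge0// ltW.
    by rewrite poweRyr// invr_eq0 gt_eqF.
  exact: (lp_sum_le (ltW p1) Xf us).
have : ((t `^ q)%:E < \esum_(u in S) (modulus (a u) `^ q)%:E)%E.
  move: tS (esumq0 S a); case: (\esum_(_ in S) _)%E => [x| |]//;
    last by rewrite ltry.
  rewrite poweR_EFin !lte_fin lee_fin => tx x0.
  rewrite -[x]powRr1// -(@mulVf _ q) ?gt_eqF// powRrM.
  by apply: gt0_ltr_powR => //; rewrite ?nnegrE ?powR_ge0.
move=> /lt_esum[s [us sS]].
set Aq := \sum_(u <- s) _ => tA.
have Aq0 : 0 < Aq by rewrite (le_lt_trans _ tA)// powR_ge0.
(* This factor makes the pairing with [a] equal to [t]. *)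
pose c := t / Aq; have c0 : 0 <= c by rewrite divr_ge0// ltW.
exists s, (fun u => of_real k (c * modulus (a u) `^ q) / a u); split=> //.
  apply: (proj2 (proj1 (lp_normP (ltW p1) _ ler01) _)) => s' us'.
  rewrite powR1.
  have term_le v : modulus (trunc s (fun u =>
    of_real k (c * modulus (a u) `^ q) / a u) v) `^ p =
      if v \in s then c `^ p * modulus (a v) `^ q else 0.
    rewrite /trunc; case: ifP => _; last by rewrite modulus0 powR0// gt_eqF.
    rewrite modulusM modulusV modulus_of_real.
    rewrite ger0_norm; last by rewrite mulr_ge0// powR_ge0.
    rewrite -mulrA powRM//; last by rewrite divr_ge0 ?powR_ge0 ?modulus_ge0.
    have [->|av] := eqVneq (a v) 0.
      by rewrite modulus0 invr0 mulr0 !powR0 ?gt_eqF.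
    (* |a|^q / |a| is |a|^(q-1), and (q - 1) p = q. *)
    congr (_ * _); rewrite -{1}(mulr_powRB1 (modulus_ge0 (a v)) q0) mulrAC
      divff ?modulus_eq0// mul1r.
    by rewrite -powRrM; congr (_ `^ _);
      rewrite mulrBl mul1r mulrC -conjugate_exponentE; ring.
  under eq_bigr do rewrite term_le.
  rewrite -big_mkcond -big_filter/=.
  apply: (@le_trans _ _ (\sum_(v <- s) c `^ p * modulus (a v) `^ q)).
    rewrite (perm_big [seq v <- s | v \in s'])/=; last first.
      apply: uniq_perm; rewrite ?filter_uniq// => v.
      by rewrite !mem_filter andbC.
    rewrite big_filter big_mkcond; apply: ler_sum => v _.
    by case: ifP => // _; rewrite mulr_ge0 ?powR_ge0.
  have AV : 0 <= Aq^-1 by rewrite invr_ge0 ltW.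
  rewrite -mulr_sumr -/Aq /c powRM// powR_invr//.
  rewrite mulrAC ler_pdivrMr ?powR_gt0// mul1r -(mulr_powRB1 (ltW Aq0) p0).
  rewrite mulrC ler_wpM2l ?(ltW Aq0)//.
  (* What remains is t^p <= Aq^(p-1), the power [p - 1] of t^q < Aq. *)
  have {1}-> : p = q * (p - 1)
    by rewrite mulrBr mulr1 mulrC -conjugate_exponentE; ring.
  rewrite powRrM; apply: ge0_ler_powR;
    rewrite ?nnegrE ?powR_ge0 ?subr_ge0 ?(ltW p1) ?(ltW Aq0)//.
  exact: ltW.
transitivity (\sum_(u <- s) of_real k (c * modulus (a u) `^ q)).
  apply: eq_bigr => u _; have [->|au] := eqVneq (a u) 0;
    last by rewrite mulrC divfK.
  by rewrite modulus0 powR0 ?gt_eqF// mulr0 rmorph0 !mul0r.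
by rewrite -rmorph_sum/= -mulr_sumr divfK// gt_eqF.
Qed.

End Conjugate.
End LpDual.

(** The three cases differ only in the dual norm inserted in [chain_recurrent_shiftP]. All sums are
    taken in the extended reals, so divergence of the series in (i) is equality with [+oo]. *)
Theorem theorem3p1 (R : realType) (k : scalar_kind) (V : countType)
    (E : rel V) (lam : V -> scalar_field R k) :
  directed_tree E -> unrooted E -> leafless E ->
  (forall v, lam v != 0) ->
  let B := backward_shift E lam in
  let pw := path_weight E lam in
  let parn (n : nat) (v : V) := iter n (par E) v in
  [/\ (bounded_shift_on E lam (lp_space 1) (lp_norm 1) ->
       (chain_recurrent_on (lp_space 1) (norm_dist (lp_norm 1)) B <->
        forall v : V,
          (\sum_(0 <= n <oo)
             ereal_sup [set (modulus (pw n u))%:E | u in Chin E n v])%E = +oo%E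
          /\
          (fun n : nat => (\sum_(0 <= j < n)
             ereal_sup [set (modulus (pw j u / pw n v))%:E
                       | u in Chin E j (parn n v)])%E) @ \oo --> +oo%E)),

      (forall p q : R, 1 < p -> p^-1 + q^-1 = 1 ->
       bounded_shift_on E lam (lp_space p) (lp_norm p) ->
       (chain_recurrent_on (lp_space p) (norm_dist (lp_norm p)) B <->
        forall v : V,
          (\sum_(0 <= n <oo)
             (\esum_(u in Chin E n v) (modulus (pw n u) `^ q)%:E) `^ q^-1)%E
            = +oo%E
          /\
          (fun n : nat => (\sum_(0 <= j < n)
             (\esum_(u in Chin E j (parn n v))
                (modulus (pw j u / pw n v) `^ q)%:E) `^ q^-1)%E)
            @ \oo --> +oo%E)) &

      (bounded_shift_on E lam (@c0_space R k V) (@sup_norm R k V) ->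
       (chain_recurrent_on (@c0_space R k V) (norm_dist (@sup_norm R k V)) B <->
        forall v : V,
          (\sum_(0 <= n <oo)
             \esum_(u in Chin E n v) (modulus (pw n u))%:E)%E = +oo%E
          /\
          (fun n : nat => (\sum_(0 <= j < n)
             \esum_(u in Chin E j (parn n v))
               (modulus (pw j u / pw n v))%:E)%E) @ \oo --> +oo%E))].
Proof.
move=> treeE unrootedE leaflessE lam_neq0 B pw parn.
(* Condition (i) carries no quotient, so the division by [c = 1] is removed. *)
have level1 D v : (\sum_(0 <= n <oo) level_norm E lam D 1 v n =
    \sum_(0 <= n <oo) D (Chin E n v) (pw n))%E.
  apply: eq_eseriesr => n _; rewrite /level_norm; congr (D _ _).
  by apply/funext => u; rewrite divr1.
have conclude X N D : sequence_space X N -> dual_norm X N D ->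
    bounded_shift_on E lam X N ->
    chain_recurrent_on X (norm_dist N) B <-> forall v,
      (\sum_(0 <= n <oo) D (Chin E n v) (pw n) = +oo)%E /\
      (fun n => \sum_(0 <= j < n)
         D (Chin E j (parn n v)) (fun u => pw j u / pw n v)%R)%E @ \oo --> +oo%E.
  move=> XN DN bnd.
  rewrite (chain_recurrent_shiftP treeE unrootedE leaflessE lam_neq0 XN DN bnd).
  by split=> levels v; have := levels v; rewrite level1.
split=> [|p q p1 pq|].
- by apply: (conclude _ _ _ _ (l1_dual_norm R k V)); exact: lp_sequence_space.
- apply: (conclude _ _ _ _ (lp_dual_norm k V p1 pq)).
  by apply: lp_sequence_space; exact: ltW.
- by apply: (conclude _ _ _ _ (c0_dual_norm R k V)); exact: c0_sequence_space.
Qed.
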